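(* Let $(a,b)$ be a pair of coprime positive integers. The anthyphairetic triangle $T(a,b)$ of $(a,b)$ is isomorphic, as an undecorated simplicial complex, to the lotus $\Lambda(b/a)$ of the rational number $b/a$.
   Context: **Lotus.** Let $N$ be a free abelian group of rank two with a basis $(e_1,e_2)$, and let $N_{\mathbb{R}} := N\otimes_{\mathbb{Z}}\mathbb{R}$. For a basis $(f_1,f_2)$ of $N$, its petal $\delta(f_1,f_2)$ is the triangle in $N_{\mathbb{R}}$ with vertices $f_1, f_2, f_1+f_2$; its base is the segment $[f_1,f_2]$ and its summit is $f_1+f_2$. The universal lotus $\Lambda(e_1,e_2)$ is the simplicial complex of pure dimension two in $N_{\mathbb{R}}$ whose triangles are the petals $\delta(f_1,f_2)$ associated to all bases $(f_1,f_2)$ of $N$ such that $f_1,f_2$ have non-negative coordinates relative to $(e_1,e_2)$. For coprime positive integers $a,b$, the lotus $\Lambda(b/a)$ is the (finite) subcomplex of $\Lambda(e_1,e_2)$ consisting of those petals whose interiors intersect the segment $[0, a e_1 + b e_2]$, together with their edges and vertices. **Anthyphairetic process.** Starting from a pair $(a,b)$ of coprime positive integers, set $(a_0,b_0)=(a,b)$ and, as long as $(a_i,b_i)\neq(1,1)$, set $(a_{i+1},b_{i+1})=(a_i,b_i-a_i)$ if $a_i<b_i$ and $(a_{i+1},b_{i+1})=(a_i-b_i,b_i)$ if $a_i>b_i$. This ends at $(a_n,b_n)=(1,1)$ for some $n\ge 0$. **Subtraction rectangles.** For a pair $(a,b)$ of coprime positive integers, the subtraction rectangle $S(a,b)$ is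 a rectangle with two horizontal edges (bottom and top) and two vertical edges (left and right), with vertices decorated as follows. The lower left vertex is decorated by $a$ and the lower right vertex by $b$. If $a<b$, the upper left vertex is decorated by $a$ and the upper right vertex by $b-a$. If $a>b$, the upper left vertex is decorated by $a-b$ and the upper right vertex by $b$. If $(a,b)=(1,1)$, the two upper vertices are left undecorated. **Anthyphairetic rectangle.** $R(a,b)$ is obtained by stacking, from bottom to top, the subtraction rectangles $S(a_0,b_0), S(a_1,b_1),\dots,S(a_n,b_n)=S(1,1)$ of the pairs generated by the anthyphairetic process applied to $(a,b)$: for $0\le i<n$, the top edge of $S(a_i,b_i)$ is identified with the bottom edge of $S(a_{i+1},b_{i+1})$ (left vertex with left vertex, right vertex with right vertex; the decorations agree). **Anthyphairetic triangle.** $T(a,b)$ is obtained from $R(a,b)$ by contracting to points the following edges: every vertical edge of one of the stacked subtraction rectangles whose two endpoints carry the same numerical decoration, and the top edge of the subtraction rectangle $S(1,1)$. Exactly one edge of each of the stacked rectangles is contracted, so each rectangle becomes a triangle, and $T(a,b)$ is viewed as the two-dimensional simplicial complex whose triangles are the images of these rectangles (with their edges and vertices). *)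

(* Defs.v *)
From HB Require Import structures.
From mathcomp Require Import all_boot all_order all_algebra.
From mathcomp Require Import all_classical all_reals.

Set Implicit Arguments.
Unset Strict Implicit.
Unset Printing Implicit Defensive.

Import Order.TTheory GRing.Theory Num.Theory.

Local Open Scope classical_set_scope.
Local Open Scope ring_scope.

(* A simplex is represented by its set of vertices; the empty simplex is
   excluded. *)
Record simplicial_complex (V : Type) := SimplicialComplex {
  simplices :> set (set V);
  simplex_finite : forall s, simplices s -> finite_set s;
  simplex_nonempty : forall s, simplices s -> s !=set0;
  simplex_face : forall s t, simplices s -> t `<=` s -> t !=set0 -> simplices t
}.

Definition vertices (V : Type) (K : simplicial_complex V) : set V :=
  [set v | simplices K [set v]].

Definition sc_isomorphic (V W : Type)
    (K : simplicial_complex V) (L : simplicial_complex W) : Prop :=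
  exists f : V -> W, set_bij (vertices K) (vertices L) f /\
    forall s, s `<=` vertices K -> (simplices K s <-> simplices L (f @` s)).

Section GeneratedComplex.
Variables (V : Type) (F : set (set V)).
Hypothesis F_finite : forall s, F s -> finite_set s.

Definition faces_of : set (set V) :=
  [set s | s !=set0 /\ exists2 t, F t & s `<=` t].

Lemma faces_of_finite s : faces_of s -> finite_set s.
Proof. by move=> [_ [t Ft /sub_finite_set]]; apply; exact: F_finite. Qed.

Lemma faces_of_nonempty s : faces_of s -> s !=set0.
Proof. by case. Qed.

Lemma faces_of_face s t : faces_of s -> t `<=` s -> t !=set0 -> faces_of t.
Proof. by move=> [_ [u Fu su]] ts t0; split=> //; exists u => // x /ts /su. Qed.

Definition generated_complex : simplicial_complex V :=
  SimplicialComplex faces_of_finite faces_of_nonempty faces_of_face.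

End GeneratedComplex.

Section Lotus.
Variables (R : realType) (N : zmodType) (NR : lmodType R).
Variable iota : {additive N -> NR}.

(* Universal property of the canonical map from N to its tensor product with
   the reals over the integers. *)
Definition is_real_extension : Prop :=
  forall (W : lmodType R) (g : {additive N -> W}),
    exists h : {linear NR -> W}, (forall v, h (iota v) = g v) /\
      forall h' : {linear NR -> W}, (forall v, h' (iota v) = g v) -> h' =1 h.

Definition is_basis (f1 f2 : N) : Prop :=
  forall v, exists! c : int * int, v = f1 *~ c.1 + f2 *~ c.2.

Definition nonneg_coords (e1 e2 f : N) : Prop :=
  exists x y : int, [/\ 0 <= x, 0 <= y & f = e1 *~ x + e2 *~ y].

Definition petal (f1 f2 : N) : set NR :=
  [set iota f1; iota f2; iota (f1 + f2)].

(* Open triangle: the points with positive barycentric coordinates. *)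
Definition petal_interior (f1 f2 : N) : set NR :=
  [set p | exists x y z : R, [/\ 0 < x, 0 < y, 0 < z, x + y + z = 1 &
     p = x *: iota f1 + y *: iota f2 + z *: iota (f1 + f2)]].

Definition segment0 (q : NR) : set NR :=
  [set p | exists t : R, [/\ 0 <= t, t <= 1 & p = t *: q]].

Definition universal_lotus_basis (e1 e2 f1 f2 : N) : Prop :=
  [/\ is_basis f1 f2, nonneg_coords e1 e2 f1 & nonneg_coords e1 e2 f2].

Definition universal_lotus_petals (e1 e2 : N) : set (set NR) :=
  [set s | exists f1 f2, universal_lotus_basis e1 e2 f1 f2 /\ s = petal f1 f2].

Definition lotus_petals (e1 e2 : N) (a b : nat) : set (set NR) :=
  [set s | exists f1 f2, [/\ universal_lotus_basis e1 e2 f1 f2,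
     petal_interior f1 f2 `&` segment0 (iota (e1 *+ a + e2 *+ b)) !=set0 &
     s = petal f1 f2]].

Lemma petal_finite f1 f2 : finite_set (petal f1 f2).
Proof. by rewrite /petal !finite_setU; do !split; exact: finite_set1. Qed.

Lemma universal_lotus_petals_finite e1 e2 s :
  universal_lotus_petals e1 e2 s -> finite_set s.
Proof. by move=> [f1 [f2 [_ ->]]]; exact: petal_finite. Qed.

Lemma lotus_petals_finite e1 e2 a b s :
  lotus_petals e1 e2 a b s -> finite_set s.
Proof. by move=> [f1 [f2 [_ _ ->]]]; exact: petal_finite. Qed.

Definition universal_lotus (e1 e2 : N) : simplicial_complex NR :=
  generated_complex (@universal_lotus_petals_finite e1 e2).

(* The lotus of b / a, for coprime positive a and b. *)
Definition lotus (e1 e2 : N) (a b : nat) : simplicial_complex NR :=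
  generated_complex (@lotus_petals_finite e1 e2 a b).

Lemma lotus_sub_universal e1 e2 a b :
  lotus e1 e2 a b `<=` universal_lotus e1 e2.
Proof.
move=> s [s0 [t [f1 [f2 [bf _ ->]]] st]].
by split=> //; exists (petal f1 f2) => //; exists f1, f2.
Qed.

End Lotus.

Local Open Scope nat_scope.

Definition anthyphairetic_step (p : nat * nat) : nat * nat :=
  if p.1 < p.2 then (p.1, p.2 - p.1) else (p.1 - p.2, p.2).

Definition anthyphairetic_pair (a b i : nat) : nat * nat :=
  iter i anthyphairetic_step (a, b).

(* The least n such that the n-th pair is (1, 1); the search bound is large
   enough because each step decreases the sum of the pair. *)
Definition anthyphairetic_length (a b : nat) : nat :=
  find (fun i => anthyphairetic_pair a b i == (1, 1)) (seq.iota 0 (a + b)).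

Lemma anthyphairetic_lengthP a b : 0 < a -> 0 < b -> coprime a b ->
  let n := anthyphairetic_length a b in
  anthyphairetic_pair a b n = (1, 1) /\
  forall i, i < n -> anthyphairetic_pair a b i <> (1, 1).
Proof.
move=> a0 b0 cab n.
have ex m : forall c d, c + d <= m -> 0 < c -> 0 < d -> coprime c d ->
    exists2 i, i < c + d & anthyphairetic_pair c d i = (1, 1).
  elim: m => [|m IH] c d; first by case: c.
  move=> cdm c0 d0 cop; case: (ltngtP c d) => cd.
  - have dlt : d < c + d by rewrite -[ltnLHS]add0n ltn_add2r.
    have ccop : coprime c (d - c).
      by move: cop; rewrite /coprime -{1}(subnK (ltnW cd)) gcdnDr.
    have := IH c (d - c); rewrite subn_gt0 (subnKC (ltnW cd)).
    move=> /(_ (leq_trans dlt cdm) c0 cd ccop) [i ilt iE].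
    exists i.+1; first exact: leq_ltn_trans ilt dlt.
    by rewrite /anthyphairetic_pair iterSr /anthyphairetic_step /= cd.
  - have clt : c < c + d by rewrite -[ltnLHS]addn0 ltn_add2l.
    have ccop : coprime (c - d) d.
      by move: cop; rewrite /coprime -{1}(subnK (ltnW cd)) ![gcdn _ d]gcdnC gcdnDr.
    have := IH (c - d) d; rewrite subn_gt0 (subnK (ltnW cd)).
    move=> /(_ (leq_trans clt cdm) cd d0 ccop) [i ilt iE].
    exists i.+1; first exact: leq_ltn_trans ilt clt.
    by rewrite /anthyphairetic_pair iterSr /anthyphairetic_step /= ltnNge ltnW.
  - by move: cop; rewrite -cd /coprime gcdnn => /eqP ->; exists 0.
have [i ilt iE] := ex _ a b (leqnn _) a0 b0 cab.
have hasP : has (fun i => anthyphairetic_pair a b i == (1, 1)) (seq.iota 0 (a + b)).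
  by apply/hasP; exists i; rewrite ?mem_iota ?iE.
have nlt : n < a + b by rewrite -[ltnRHS](size_iota 0) -has_find.
split; first by have /eqP := nth_find 0 hasP; rewrite nth_iota.
move=> j jn; apply/eqP; have := before_find 0 jn.
by rewrite nth_iota ?(ltn_trans jn) // => ->.
Qed.

Definition left_side := false.
Definition right_side := true.

(* Decorations of the lower and upper vertices on each side; None means
   undecorated. *)
Record subtraction_rectangle := SubtractionRectangle {
  lower : bool -> nat;
  upper : bool -> option nat
}.

(* The last branch is meant for the pair (1, 1), the only coprime pair with
   equal entries. *)
Definition subtraction_rect (p : nat * nat) : subtraction_rectangle :=
  let: (a, b) := p in
  SubtractionRectangle
    (fun s => if s == left_side then a else b)
    (fun s =>
      if a < b then Some (if s == left_side then a else b - a)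
      else if b < a then Some (if s == left_side then a - b else b)
      else None).

Section AnthyphaireticTriangle.
Variables a b : nat.
Local Notation n := (anthyphairetic_length a b).

(* A vertex of the anthyphairetic rectangle is a level with a side; the i-th
   stacked rectangle lies between the levels i and i + 1, so that its top edge
   is the bottom edge of the next one. *)
Definition rect_vertex : finType := ('I_n.+2 * bool)%type.

Definition rect_lower (i : 'I_n.+1) (s : bool) : rect_vertex :=
  (widen_ord (leqnSn n.+1) i, s).

Definition rect_upper (i : 'I_n.+1) (s : bool) : rect_vertex :=
  (lift ord0 i, s).

Definition stacked_rect (i : 'I_n.+1) : subtraction_rectangle :=
  subtraction_rect (anthyphairetic_pair a b i).

Definition contracted_edge : rel rect_vertex := fun x y =>
  [exists i, exists s,
     [&& x == rect_lower i s, y == rect_upper i s &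
         upper (stacked_rect i) s == Some (lower (stacked_rect i) s)]]
  || (x == rect_upper ord_max left_side) && (y == rect_upper ord_max right_side).

(* The image in the anthyphairetic triangle of a vertex of the rectangle is its
   class for the equivalence relation generated by the contracted edges. *)
Definition contraction (x : rect_vertex) : set rect_vertex :=
  [set y | connect (fun u v => contracted_edge u v || contracted_edge v u) x y].

Definition rect_corners (i : 'I_n.+1) : set rect_vertex :=
  [set x | exists s, x = rect_lower i s \/ x = rect_upper i s].

Definition anthyphairetic_triangles : set (set (set rect_vertex)) :=
  [set t | exists i, t = contraction @` rect_corners i].

Lemma anthyphairetic_triangles_finite t :
  anthyphairetic_triangles t -> finite_set t.
Proof. by move=> [i ->]; apply: finite_image; exact: finite_finset. Qed.

Definition anthyphairetic_triangle : simplicial_complex (set rect_vertex) :=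
  generated_complex anthyphairetic_triangles_finite.

End AnthyphaireticTriangle.

(* Main.v *)
Require Import Defs.
From HB Require Import structures.
From mathcomp Require Import all_boot all_order all_algebra.
From mathcomp Require Import all_classical all_reals.
From mathcomp Require Import zify ring lra.

(** Write [v = a e1 + b e2].  Running the anthyphairetic process on [(a, b)]
    produces along with the pairs [(a_i, b_i)] a sequence of bases [(f_i, g_i)]
    of the lattice with [v = a_i f_i + b_i g_i]: start from [(e1, e2)], and
    replace [(f, g)] by [(f + g, g)] or by [(f, f + g)] according to which entry
    is subtracted from the other, because
    [a f + b g = a (f + g) + (b - a) g = (a - b) f + b (f + g)].

    On the side of the lotus, the interior of the petal of a basis [(f, g)]
    meets [[0, v]] if and only if [v] has positive coordinates in [(f, g)]
    ([petal_interior_meets_segment]).  A basis inside the cone of [(e1, e2)] is,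
    up to order, [(e1, e2)] itself, or else it lies in one of the two halves cut
    by [e1 + e2] ([petal_same_side], a determinant computation).  The half
    that contains [v] is spanned by the next basis of the sequence, so a descent
    on [a + b] shows that the petals of the lotus are exactly those of the
    [(f_i, g_i)] for [i <= n] ([basis_around_is_petal_basis]).

    On the side of the triangle, send the left and right vertices at level
    [i <= n] to [g_i] and [f_i], and both vertices at the top level [n + 1] to
    the last summit [f_n + g_n].  The sides are exchanged because subtracting
    [a] from [b] preserves the left decoration and the vector [g].  A vertical
    edge is contracted precisely when the vector attached to that side does not
    change; the other upper vertex carries the summit [f_i + g_i], which is
    different from all vectors met at the levels up to [i], since it is interior
    to all the previous cones ([basis_vector_not_inner]).  Hence two vertices
    are identified by the contraction if and only if they carry the same vector
    ([contractionP]), and the [i]-th rectangle becomes the [i]-th petal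
    ([corner_vector_image]).  A map that is injective on vertices and matches
    the triangles is an isomorphism ([generated_complex_isomorphic]). *)

Set Implicit Arguments.
Unset Strict Implicit.
Unset Printing Implicit Defensive.

Import Order.TTheory GRing.Theory Num.Theory.
Local Open Scope classical_set_scope.
Local Open Scope ring_scope.

(** * Isomorphisms of generated complexes *)

Lemma generated_complex_isomorphic (V W : Type) (F : set (set V))
    (G : set (set W)) (Ffin : forall s, F s -> finite_set s)
    (Gfin : forall s, G s -> finite_set s) (phi : V -> W) :
  G = [set phi @` t | t in F] ->
  {in \bigcup_(t in F) t &, injective phi} ->
  sc_isomorphic (generated_complex Ffin) (generated_complex Gfin).
Proof.
move=> GE phiI.
have vertP v : vertices (generated_complex Ffin) v -> (\bigcup_(t in F) t) v.
  by move=> [_ [t Ft vt]]; exists t => //; exact: vt.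
have injF v w : (\bigcup_(t in F) t) v -> (\bigcup_(t in F) t) w ->
    phi v = phi w -> v = w by move=> Fv Fw; apply: phiI; rewrite inE.
exists phi; split; first split.
- move=> v [_ [t Ft vt]]; split; first by exists (phi v).
  exists (phi @` t); first by rewrite GE; exists t.
  by move=> _ ->; exists v => //; exact: vt.
- by move=> v w /set_mem/vertP Fv /set_mem/vertP Fw; exact: injF.
- move=> w [_ [u]]; rewrite GE => -[t Ft <-] wt.
  have [v tv <-] := wt w erefl.
  by exists v => //; split; [exists v | exists t => // _ ->].
move=> s sK; split=> [[[v sv] [t Ft st]]|[[_ [v sv _]] [u]]].
  split; first by exists (phi v), v.
  by exists (phi @` t); [rewrite GE; exists t | exact: image_subset].
rewrite GE => -[t Ft <-] st; split; first by exists v.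
exists t => // w sw.
have [w' tw' e] : (phi @` t) (phi w) by apply: st; exists w.
rewrite -(@injF w' w) //; first by exists t.
exact/vertP/sK.
Qed.

(** * Bases of a lattice of rank two *)

Section Bases.
Variable N : zmodType.
Implicit Types e f g v : N.

Lemma is_basis_swap f g : is_basis f g -> is_basis g f.
Proof.
move=> b v; have [[x y] [/= vE u]] := b v.
exists (y, x); split=> [|[x' y'] /= v'E]; first by rewrite addrC.
by have := u (y', x'); rewrite addrC /= => /(_ v'E) [-> ->].
Qed.

Lemma is_basis_inj f g (x y x' y' : int) : is_basis f g ->
  f *~ x + g *~ y = f *~ x' + g *~ y' -> x = x' /\ y = y'.
Proof.
move=> b e; have [c [_ u]] := b (f *~ x + g *~ y).
by have := u (x, y) erefl; rewrite (u (x', y') e) => -[-> ->].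
Qed.

Lemma shear_coords f g (x y : int) :
  f *~ x + g *~ y = (f + g) *~ x + g *~ (y - x).
Proof. by rewrite mulrzBr mulrzDl -addrA [g *~ x + _]addrC subrK. Qed.

Lemma is_basis_shear f g : is_basis f g -> is_basis (f + g) g.
Proof.
move=> b v; have [[x y] [/= vE _]] := b v.
exists (x, y - x); split=> [|[x' y'] /= v'E]; first by rewrite /= -shear_coords.
have [] := @is_basis_inj f g x y x' (y' + x') b.
  by rewrite -vE v'E [RHS]shear_coords addrK.
by move=> -> ->; rewrite addrK.
Qed.

Lemma is_basis_shearr f g : is_basis f g -> is_basis f (f + g).
Proof.
move=> b; apply: is_basis_swap; rewrite addrC.
exact/is_basis_shear/is_basis_swap.
Qed.

Lemma compose_coords e1 e2 (x y z w p q : int) :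
  (e1 *~ x + e2 *~ y) *~ p + (e1 *~ z + e2 *~ w) *~ q =
  e1 *~ (x * p + z * q) + e2 *~ (y * p + w * q).
Proof. by rewrite !mulrzDl !mulrzDr -!mulrzA addrACA. Qed.

(** The two change of basis matrices are inverse to each other, so their
    determinants are integers with product 1. *)
Lemma is_basis_det e1 e2 (x y z w : int) : is_basis e1 e2 ->
  is_basis (e1 *~ x + e2 *~ y) (e1 *~ z + e2 *~ w) ->
  x * w - y * z = 1 \/ x * w - y * z = -1.
Proof.
move=> be bf.
have [[p q] [/= + _]] := bf e1; have [[r s] [/= + _]] := bf e2.
rewrite !compose_coords -[X in X = _ -> _]add0r -[X in _ -> X = _ -> _]addr0.
rewrite -[X in _ + X = _ -> _]mulr1z -[X in _ -> X + _ = _ -> _]mulr1z.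
rewrite -[X in X + _ = _ -> _](mulr0z e1) -[X in _ -> _ + X = _ -> _](mulr0z e2).
move=> /(is_basis_inj be)[e12 e22] /(is_basis_inj be)[e11 e21].
have : (p * s - q * r) * (x * w - y * z) = 1.
  rewrite (_ : _ * _ = (x * p + z * q) * (y * r + w * s) -
    (x * r + z * s) * (y * p + w * q)); last by ring.
  by rewrite -e11 -e22 -e12 -e21 mulr0 subr0 mulr1.
by move=> /intUnitRing.unitzPl/orP[]/eqP; [left | right].
Qed.

Lemma nonneg_coords_swap e1 e2 f : nonneg_coords e1 e2 f -> nonneg_coords e2 e1 f.
Proof. by move=> [x [y [x0 y0 ->]]]; exists y, x; rewrite addrC. Qed.

Lemma nonneg_coords_comb e1 e2 f g (m k : nat) :
  nonneg_coords e1 e2 f -> nonneg_coords e1 e2 g ->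
  nonneg_coords e1 e2 (f *+ m + g *+ k).
Proof.
move=> [x [y [x0 y0 ->]]] [z [w [z0 w0 ->]]].
exists (x * m%:Z + z * k%:Z), (y * m%:Z + w * k%:Z).
by split; [lia | lia | exact: (compose_coords _ _ _ _ _ _ m%:Z k%:Z)].
Qed.

(** If [e1] were such a combination, the [e2]-coordinates of [f] and [g], being
    non-negative, would both vanish, and the determinant would be zero. *)
Lemma basis_vector_not_inner e1 e2 f g (m k : nat) :
  is_basis e1 e2 -> is_basis f g -> nonneg_coords e1 e2 f ->
  nonneg_coords e1 e2 g -> (0 < m)%N -> (0 < k)%N -> e1 <> f *+ m + g *+ k.
Proof.
move=> be bf [x [y [x0 y0 fE]]] [z [w [z0 w0 gE]]] m0 k0.
rewrite fE gE in bf *.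
rewrite -[_ *+ m]/(_ *~ m%:Z) -[_ *+ k]/(_ *~ k%:Z) compose_coords.
rewrite -[X in X = _]addr0 -[X in X + _ = _]mulr1z -[X in _ + X = _](mulr0z e2).
move=> /(is_basis_inj be)[_ e].
have [y0' w0'] : y = 0 /\ w = 0 by nia.
by have := is_basis_det be bf; rewrite y0' w0'; lia.
Qed.

(** Suppose that [f = (x, y)] and [g = (z, w)] lie strictly on opposite sides of
    the diagonal.  If [x < y] and [w < z], then
    [y z - x w >= (x + 1) (w + 1) - x w = x + w + 1], and this determinant is at
    most 1, which forces [x = w = 0] and [y = z = 1]; the other case is
    symmetric. *)
Lemma petal_same_side e1 e2 f g : is_basis e1 e2 -> is_basis f g ->
  nonneg_coords e1 e2 f -> nonneg_coords e1 e2 g ->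
  [\/ (f, g) = (e1, e2), (g, f) = (e1, e2),
      nonneg_coords (e1 + e2) e2 f /\ nonneg_coords (e1 + e2) e2 g |
      nonneg_coords e1 (e1 + e2) f /\ nonneg_coords e1 (e1 + e2) g].
Proof.
move=> be bf [x [y [x0 y0 fE]]] [z [w [z0 w0 gE]]].
rewrite fE gE in bf.
have := is_basis_det be bf => det.
have : [\/ [/\ x = 1, y = 0, z = 0 & w = 1], [/\ x = 0, y = 1, z = 1 & w = 0],
    x <= y /\ z <= w | y <= x /\ w <= z].
  case: (lerP x y) => xy; case: (lerP z w) => zw.
  - by apply: Or43.
  - case: (ltrP x y) => xy'; last by apply: Or44; lia.
    by apply: Or42; split; nia.
  - case: (ltrP z w) => zw'; last by apply: Or44; lia.
    by apply: Or41; split; nia.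
  - by apply: Or44; lia.
case=> [[? ? ? ?]|[? ? ? ?]|[xy zw]|[yx wz]]; subst.
- by apply: Or41; rewrite !mulr1z !mulr0z addr0 add0r.
- by apply: Or42; rewrite !mulr1z !mulr0z addr0 add0r.
- apply: Or43; split; [exists x, (y - x)|exists z, (w - z)].
    by split; [lia | lia | exact: shear_coords].
  by split; [lia | lia | exact: shear_coords].
- apply: Or44; split; [exists (x - y), y|exists (z - w), w].
    by split; [lia | lia | rewrite (addrC e1 e2) [RHS]addrC -shear_coords addrC].
  by split; [lia | lia | rewrite (addrC e1 e2) [RHS]addrC -shear_coords addrC].
Qed.

End Bases.

(** * Petals crossed by a segment *)

Section RealExtension.
Variables (R : realType) (N : zmodType) (NR : lmodType R).
Variable iota : {additive N -> NR}.
Hypothesis iota_ext : is_real_extension iota.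
Implicit Types e f g v : N.

(** The universal property is only applied to this map, valued in the real line:
    its linear extension separates [iota f] from [iota g], and exchanging [f] and
    [g] gives the second coordinate. *)
Definition first_coord f g (bf : is_basis f g) v : R^o :=
  (sval (cid (bf v))).1%:~R.

Lemma first_coordE f g (bf : is_basis f g) (x y : int) :
  first_coord bf (f *~ x + g *~ y) = x%:~R.
Proof.
by rewrite /first_coord; case: cid => -[x' y'] /= [/(is_basis_inj bf)[<- _] _].
Qed.

Lemma first_coord_is_additive f g (bf : is_basis f g) :
  zmod_morphism (first_coord bf).
Proof.
move=> v w; have [[x y] [/= -> _]] := bf v; have [[z t] [/= -> _]] := bf w.
by rewrite opprD addrACA -(mulrzBr f) -(mulrzBr g) !first_coordE intrB.
Qed.

HB.instance Definition _ f g (bf : is_basis f g) :=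
  GRing.isZmodMorphism.Build N R^o (first_coord bf) (first_coord_is_additive bf).

Lemma real_extension_inj f g (x y x' y' : R) : is_basis f g ->
  x *: iota f + y *: iota g = x' *: iota f + y' *: iota g -> x = x' /\ y = y'.
Proof.
have half u v (p q p' q' : R) : is_basis u v ->
    p *: iota u + q *: iota v = p' *: iota u + q' *: iota v -> p = p'.
  move=> b; have [h [hE _]] := iota_ext (first_coord b).
  have hu : h (iota u) = 1.
    by have := first_coordE b 1 0; rewrite mulr1z mulr0z addr0 hE.
  have hv : h (iota v) = 0.
    by have := first_coordE b 0 1; rewrite mulr1z mulr0z add0r hE.
  move=> /(congr1 h); rewrite !linearD !linearZ /= hu hv.
  by rewrite /GRing.scale /= !mulr1 !mulr0 !addr0.
move=> b e; split; first exact: half b e.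
by apply: (half g f y x y' x' (is_basis_swap b)); rewrite addrC e addrC.
Qed.

Lemma real_extension_injective e1 e2 : is_basis e1 e2 -> injective iota.
Proof.
move=> be v w; have [[x y] [/= -> _]] := be v; have [[z t] [/= -> _]] := be w.
rewrite !raddfD !raddfMz /= -!(@scaler_int R).
by case/(real_extension_inj be) => /intr_inj -> /intr_inj ->.
Qed.

(** In the basis [(f, g)] the interior of the petal consists of the points
    [(c, d)] with [0 < c < 1], [0 < d < 1] and [1 < c + d].  It therefore meets
    the ray through [(m, k)] when [m] and [k] are positive integers, since
    [m + k] is then larger than both [m] and [k]. *)
Lemma petal_interior_meets_segment f g v : is_basis f g ->
  petal_interior iota f g `&` segment0 (iota v) !=set0 <->
  exists m k : nat, [/\ (0 < m)%N, (0 < k)%N & v = f *+ m + g *+ k].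
Proof.
move=> bf; split=> [[_ [[x [y [z [x0 y0 z0 _ ->]]]] [t [t0 _]]]]|].
  have [[p q] [/= -> _]] := bf v.
  rewrite !raddfD !raddfMz /= -!(@scaler_int R) !scalerA addrACA.
  rewrite -!scalerDl => /(real_extension_inj bf)[pE qE].
  have pos (r : int) (c : R) : 0 < c -> c = r%:~R * t -> 0 < r.
    move=> c0 cE; rewrite ltNge; apply/negP => r0.
    have : r%:~R * t <= 0 by rewrite mulr_le0_ge0// lerz0.
    by rewrite -cE leNgt c0.
  have p0 : 0 < p by apply: pos pE; rewrite addr_gt0.
  have q0 : 0 < q by apply: pos qE; rewrite addr_gt0.
  by exists `|p|%N, `|q|%N; split; [lia | lia | rewrite !pmulrn !gtz0_abs].
move=> [m [k [m0 k0 ->]]].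
have M1 : 1 <= m%:R :> R by rewrite ler1n.
have K1 : 1 <= k%:R :> R by rewrite ler1n.
(* The barycentric coordinates of the common point are [M^2], [K^2] and [M K],
   divided by their sum [D]. *)
set M : R := m%:R in M1 *; set K : R := k%:R in K1 *.
have D0 : 0 < M ^+ 2 + M * K + K ^+ 2 by nra.
set D := _ + K ^+ 2 in D0.
have Dn0 : D != 0 by rewrite gt_eqF.
exists (((M + K) / D) *: iota (f *+ m + g *+ k)); split; last first.
  exists ((M + K) / D); split=> //; first by apply: divr_ge0; nra.
  by rewrite ler_pdivrMr // mul1r /D; nra.
exists (M ^+ 2 / D), (K ^+ 2 / D), (M * K / D).
split; try by apply: divr_gt0 => //; nra.
  by rewrite /D; field.
rewrite !raddfD !raddfMn /= -!(@scaler_nat R) -/M -/K !scalerA.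
by rewrite addrACA -!scalerDl; congr (_ *: _ + _ *: _); field.
Qed.

End RealExtension.

(** * Bases following the anthyphairetic process *)

Section Refinement.
Variable N : zmodType.
Implicit Types (e f g v : N) (a b i j m k : nat).

Definition refine_petal (st : (N * N) * (nat * nat)) : (N * N) * (nat * nat) :=
  (if (st.2.1 < st.2.2)%N then (st.1.1 + st.1.2, st.1.2)
   else (st.1.1, st.1.1 + st.1.2), anthyphairetic_step st.2).

Definition petal_basis e1 e2 a b i : N * N :=
  (iter i refine_petal ((e1, e2), (a, b))).1.

Lemma petal_basisS e1 e2 a b i :
  let B := petal_basis e1 e2 a b i in let p := anthyphairetic_pair a b i in
  petal_basis e1 e2 a b i.+1 =
    if (p.1 < p.2)%N then (B.1 + B.2, B.2) else (B.1, B.1 + B.2).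
Proof.
have pairE : (iter i refine_petal ((e1, e2), (a, b))).2 =
  anthyphairetic_pair a b i by elim: i => //= i ->.
by rewrite /petal_basis iterS /= pairE.
Qed.

Lemma petal_basisSl e1 e2 a b i :
  petal_basis e1 e2 a b i.+1 =
    if (a < b)%N then petal_basis (e1 + e2) e2 a (b - a) i
    else petal_basis e1 (e1 + e2) (a - b) b i.
Proof.
by rewrite /petal_basis iterSr /refine_petal /anthyphairetic_step /=; case: ifP.
Qed.

Lemma petal_basis_is_basis e1 e2 a b i : is_basis e1 e2 ->
  is_basis (petal_basis e1 e2 a b i).1 (petal_basis e1 e2 a b i).2.
Proof.
move=> be; elim: i => [//|i IH]; rewrite petal_basisS; case: ifP => _ /=.
  exact: is_basis_shear.
exact: is_basis_shearr.
Qed.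

Lemma petal_basis_pair e1 e2 a b i :
  let B := petal_basis e1 e2 a b i in let p := anthyphairetic_pair a b i in
  e1 *+ a + e2 *+ b = B.1 *+ p.1 + B.2 *+ p.2.
Proof.
move=> /=; elim: i => [//|i ->]; rewrite petal_basisS /anthyphairetic_pair iterS.
rewrite /anthyphairetic_step -/(anthyphairetic_pair a b i); case: ltnP => pp /=.
  by rewrite mulrnDl -addrA -mulrnDr subnKC // ltnW.
by rewrite mulrnDl addrA -mulrnDr subnK.
Qed.

Lemma nonneg_coordsD e1 e2 f g : nonneg_coords e1 e2 f ->
  nonneg_coords e1 e2 g -> nonneg_coords e1 e2 (f + g).
Proof. exact: (@nonneg_coords_comb N e1 e2 f g 1 1). Qed.

Lemma nonneg_coords_basis e1 e2 :
  nonneg_coords e1 e2 e1 /\ nonneg_coords e1 e2 e2.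
Proof.
split; [exists 1, 0|exists 0, 1]; split=> //.
  by rewrite mulr1z mulr0z addr0.
by rewrite mulr1z mulr0z add0r.
Qed.

Lemma petal_basis_nonneg e1 e2 a b j i : (j <= i)%N ->
  let B := petal_basis e1 e2 a b in
  nonneg_coords (B j).1 (B j).2 (B i).1 /\ nonneg_coords (B j).1 (B j).2 (B i).2.
Proof.
move=> /subnKC <- /=; elim: (i - j)%N => [|d [IH1 IH2]].
  by rewrite addn0; exact: nonneg_coords_basis.
by rewrite addnS petal_basisS; case: ifP => _; split=> //; exact: nonneg_coordsD.
Qed.

Definition coprime_pos (p : nat * nat) : bool :=
  [&& (0 < p.1)%N, (0 < p.2)%N & coprime p.1 p.2].

Lemma coprime_pos_step p : coprime_pos p -> p <> (1, 1)%N ->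
  p.1 <> p.2 /\ coprime_pos (anthyphairetic_step p).
Proof.
case: p => a b /and3P[/= a0 b0 cab] ab1.
rewrite /coprime_pos /anthyphairetic_step /=.
case: (ltngtP a b) => ab /=.
- split; first by lia.
  by rewrite a0 subn_gt0 ab /= /coprime -gcdnDr subnK // ltnW.
- split; first by lia.
  by rewrite b0 subn_gt0 ab /= /coprime gcdnC -gcdnDr subnK 1?gcdnC // ltnW.
- by case: ab1; move: cab; rewrite -ab /coprime gcdnn => /eqP ->.
Qed.

Lemma coprime_pos_pair a b i : coprime_pos (a, b) ->
  (i <= anthyphairetic_length a b)%N -> coprime_pos (anthyphairetic_pair a b i).
Proof.
move=> cab; have/and3P[a0 b0 c] := cab.
have [_ before] := anthyphairetic_lengthP a0 b0 c.
elim: i => [//|i IH] ilt; rewrite /anthyphairetic_pair iterS.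
by case: (coprime_pos_step (IH (ltnW ilt)) (before _ ilt)).
Qed.

(** By descent on [a + b].  When [(f, g)] is not [(e1, e2)] up to order, it lies
    in one half of the cone, and so does [a e1 + b e2]; this decides between
    [a < b] and [b < a], and that half is spanned by the next basis of the
    process.  The pair [(1, 1)] is excluded at that stage, because
    [e1 + e2] would be a basis vector of the half and interior to the cone of
    [(f, g)]. *)
Lemma basis_around_is_petal_basis e1 e2 a b f g m k : coprime_pos (a, b) ->
  is_basis e1 e2 -> is_basis f g ->
  nonneg_coords e1 e2 f -> nonneg_coords e1 e2 g ->
  (0 < m)%N -> (0 < k)%N -> e1 *+ a + e2 *+ b = f *+ m + g *+ k ->
  exists2 i, (i <= anthyphairetic_length a b)%N &
    (f, g) = petal_basis e1 e2 a b i \/ (g, f) = petal_basis e1 e2 a b i.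
Proof.
move=> cab be bf f0 g0 m0 k0 vE.
(* Bounding the index by the absence of (1, 1) before it is stable under
   shifting the process by one step. *)
suff [i [before iE]] : exists i,
    (forall j, (j < i)%N -> anthyphairetic_pair a b j <> (1, 1)%N) /\
    ((f, g) = petal_basis e1 e2 a b i \/ (g, f) = petal_basis e1 e2 a b i).
  exists i => //; rewrite leqNgt; apply/negP => /before; apply.
  by have/and3P[a0 b0 c] := cab; case: (anthyphairetic_lengthP a0 b0 c).
have [s] := ubnP (a + b)%N.
elim: s => // s IH in a b e1 e2 cab be f0 g0 vE *.
rewrite ltnS => abs.
have found : (f, g) = (e1, e2) \/ (g, f) = (e1, e2) -> exists i,
    (forall j, (j < i)%N -> anthyphairetic_pair a b j <> (1, 1)%N) /\
    ((f, g) = petal_basis e1 e2 a b i \/ (g, f) = petal_basis e1 e2 a b i).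
  by exists 0%N.
case: (petal_same_side be bf f0 g0) => [fg|gf|[fu gu]|[fu gu]].
- by apply: found; left.
- by apply: found; right.
- have beu := is_basis_shear be.
  have ab1 : (a, b) <> (1, 1)%N.
    move=> [a1 b1]; apply: (basis_vector_not_inner beu bf fu gu m0 k0).
    by rewrite -vE a1 b1.
  have [/= anb cst] := coprime_pos_step cab ab1.
  have ab : (a < b)%N.
    have [x [y [x0 y0]]] := nonneg_coords_comb m k fu gu.
    rewrite -vE mulrzDl -addrA -mulrzDr
      => /(is_basis_inj be (x := a%:Z) (y := b%:Z)).
    by lia.
  have vE' : (e1 + e2) *+ a + e2 *+ (b - a) = f *+ m + g *+ k.
    by rewrite -vE mulrnDl -addrA -mulrnDr subnKC // ltnW.
  move: cst; rewrite /anthyphairetic_step /= ab => cst.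
  have/and3P[a0 _ _] := cab; rewrite /= in a0.
  have [|i [before iE]] := IH a (b - a)%N _ _ cst beu fu gu vE'; first by lia.
  exists i.+1; rewrite petal_basisSl ab; split=> // -[//|j] /before.
  by rewrite /anthyphairetic_pair iterSr /anthyphairetic_step /= ab.
- have beu := is_basis_shearr be.
  have ab1 : (a, b) <> (1, 1)%N.
    move=> [a1 b1]; apply: (basis_vector_not_inner (is_basis_swap beu) bf
      (nonneg_coords_swap fu) (nonneg_coords_swap gu) m0 k0).
    by rewrite -vE a1 b1.
  have [/= anb cst] := coprime_pos_step cab ab1.
  have ab : (b < a)%N.
    have [x [y [x0 y0]]] := nonneg_coords_comb m k fu gu.
    rewrite -vE mulrzDl addrA -mulrzDr
      => /(is_basis_inj be (x := a%:Z) (y := b%:Z)).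
    by lia.
  have vE' : e1 *+ (a - b) + (e1 + e2) *+ b = f *+ m + g *+ k.
    by rewrite -vE mulrnDl addrA -mulrnDr subnK // ltnW.
  have nab : (a < b)%N = false by rewrite ltnNge ltnW.
  move: cst; rewrite /anthyphairetic_step /= nab => cst.
  have/and3P[_ b0 _] := cab; rewrite /= in b0.
  have [|i [before iE]] := IH (a - b)%N b _ _ cst beu fu gu vE'; first by lia.
  exists i.+1; rewrite petal_basisSl nab; split=> // -[//|j] /before.
  by rewrite /anthyphairetic_pair iterSr /anthyphairetic_step /= nab.
Qed.

End Refinement.

(** * Contraction of the anthyphairetic rectangle *)

Section Contraction.
Variables (N : zmodType) (e1 e2 : N) (a b : nat).
Hypotheses (be : is_basis e1 e2) (cab : coprime_pos (a, b)).

Local Notation n := (anthyphairetic_length a b).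
Local Notation B := (petal_basis e1 e2 a b).
Local Notation p := (anthyphairetic_pair a b).
Local Notation conn := (connect
  (fun u v => @contracted_edge a b u v || @contracted_edge a b v u)).

(** The left side carries the second vector: when [a < b] the left edge is
    contracted while the second basis vector is kept. *)
Definition corner_vector (x : rect_vertex a b) : N :=
  if (x.1 <= n)%N then if x.2 == left_side then (B x.1).2 else (B x.1).1
  else (B n).1 + (B n).2.

(** Whether the upper corner carries the summit [f_i + g_i]: both sides in the
    top rectangle, and otherwise the side on which the subtraction takes place. *)
Definition new_corner (i : 'I_n.+1) (s : bool) : bool :=
  (i == n :> nat) || (s == ((p i).1 < (p i).2)%N).

Lemma corner_vector_lower i s :
  corner_vector (rect_lower i s) = if s == left_side then (B i).2 else (B i).1.
Proof. by rewrite /corner_vector /= -ltnS ltn_ord. Qed.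

Lemma corner_vector_upper i s : corner_vector (rect_upper i s) =
  if new_corner i s then (B i).1 + (B i).2 else corner_vector (rect_lower i s).
Proof.
rewrite corner_vector_lower /corner_vector /new_corner /= /bump leq0n add1n.
case: (eqVneq (i : nat) n) => [->|ni] /=; first by rewrite ltnn.
have iltn : (i < n)%N by rewrite ltn_neqAle ni -ltnS ltn_ord.
by rewrite iltn petal_basisS; case: ltnP; case: s.
Qed.

(** Below the top rectangle the entries of the pair are positive and distinct,
    so exactly one of the two decorations changes. *)
Lemma contracted_sideE i s :
  (upper (stacked_rect i) s == Some (lower (stacked_rect i) s)) =
  ~~ new_corner i s.
Proof.
have ilen : (i <= n)%N by rewrite -ltnS ltn_ord.
have/and3P[a0 b0 c] := cab; have [pn before] := anthyphairetic_lengthP a0 b0 c.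
rewrite /stacked_rect /new_corner; case: (eqVneq (i : nat) n) => [->|ni] /=.
  by rewrite pn.
have iltn : (i < n)%N by rewrite ltn_neqAle ni.
have ci := coprime_pos_pair cab ilen.
have [] := coprime_pos_step ci (before _ iltn).
case: (p i) ci => x y /and3P[/= x0 y0 _] xy _.
by case: (ltngtP x y) => xy'; case: s => //=; apply/eqP; try (case; lia);
  congr Some; lia.
Qed.

Lemma contracted_side i s : ~~ new_corner i s ->
  @contracted_edge a b (rect_lower i s) (rect_upper i s).
Proof.
rewrite -contracted_sideE => c; apply/orP; left.
by apply/existsP; exists i; apply/existsP; exists s; rewrite !eqxx.
Qed.

Lemma corner_vector_contracted x y :
  @contracted_edge a b x y -> corner_vector x = corner_vector y.
Proof.
case/orP=> [/existsP[i /existsP[s /and3P[/eqP-> /eqP->]]]|/andP[/eqP-> /eqP->]].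
  by rewrite contracted_sideE corner_vector_upper => /negbTE ->.
by rewrite !corner_vector_upper /new_corner eqxx.
Qed.

Lemma conn_sym x y : conn x y = conn y x.
Proof. by apply: sym_connect_sym => u v; rewrite orbC. Qed.

Lemma corner_vector_connected x y : conn x y -> corner_vector x = corner_vector y.
Proof.
case/connectP=> q + ->; elim: q x => //= z q IH x /andP[xz /IH <-].
by case/orP: xz => /corner_vector_contracted.
Qed.

(** The vector of [x] belongs to a basis whose cone contains [f_i] and [g_i],
    so it cannot be a combination of both with positive coefficients. *)
Lemma corner_vector_neq_summit (x : rect_vertex a b) i :
  (x.1 <= i <= n)%N -> corner_vector x <> (B i).1 + (B i).2.
Proof.
case/andP=> xi ilen; rewrite /corner_vector (leq_trans xi ilen).
have [n1 n2] := petal_basis_nonneg e1 e2 a b xi.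
have bj := petal_basis_is_basis a b x.1 be.
have bi := petal_basis_is_basis a b i be.
case: eqP => _; last exact: (@basis_vector_not_inner _ _ _ _ _ 1 1 bj bi).
by apply: (@basis_vector_not_inner _ _ _ _ _ 1 1 (is_basis_swap bj) bi);
  try exact: nonneg_coords_swap.
Qed.

(** By induction on the higher of the two levels.  An upper corner with the
    vector of the corner below it is joined to that corner by a contracted edge;
    otherwise it carries a summit, which occurs at no lower level, and which both
    corners of a level carry only at the top, where the top edge joins them. *)
Lemma connected_corner_vector x y : corner_vector x = corner_vector y -> conn x y.
Proof.
wlog xy : x y / (x.1 <= y.1)%N.
  by move=> W; case: (leqP x.1 y.1) => [|/ltnW] xy e; [|rewrite conn_sym]; apply: W.
move: xy; have [k] : exists k, k = nat_of_ord y.1 by exists y.1.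
elim: k x y => [|k IH] x y.
  case: x y => [x s] [y t] /= y0; rewrite -y0 leqn0 => /eqP x0.
  have -> : x = y by apply: val_inj; rewrite /= x0 -y0.
  have [st|st] := eqVneq s t; first by rewrite st.
  have ne : e1 <> e2.
    move=> e12; have [] := @is_basis_inj _ e1 e2 1 0 0 1 be => //.
    by rewrite !mulr1z !mulr0z addr0 add0r.
  by rewrite /corner_vector /= -y0; case: s t st => -[]//= _ E; case: ne.
move=> yk xk e.
have kn : (k < n.+1)%N by rewrite -ltnS yk.
pose i : 'I_n.+1 := Ordinal kn.
have lvl (z : rect_vertex a b) : nat_of_ord z.1 = k.+1 -> z = rect_upper i z.2.
  by case: z => z s /= zk; congr (_, _); apply: val_inj.
have upper_conn s : ~~ new_corner i s -> conn (rect_lower i s) (rect_upper i s).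
  by move=> /contracted_side c; apply: connect1; rewrite c.
have lower_neq (z : rect_vertex a b) : (z.1 <= k)%N ->
    corner_vector z <> (B i).1 + (B i).2.
  by move=> zk; apply: corner_vector_neq_summit; rewrite zk.
rewrite -yk in xk; rewrite (lvl y (esym yk)) in e *; move: (y.2) e => t e {yk}.
move: xk; rewrite leq_eqVlt => /orP[/eqP xk|xk].
  rewrite (lvl x xk) in e *; move: (x.2) e => s {xk}.
  rewrite !corner_vector_upper.
  have [<-//|st] := eqVneq s t.
  have [nis|nis] := boolP (new_corner i s); have [nit|nit] := boolP (new_corner i t).
  - move: nis nit; rewrite /new_corner; case: eqVneq => /= [ki _ _ _|_ /eqP es /eqP et].
      have -> : i = ord_max by apply: val_inj.
      have top : @contracted_edge a b (rect_upper ord_max left_side)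
          (rect_upper ord_max right_side).
        by apply/orP; right; rewrite !eqxx.
      by case: s t st => -[]//= _; apply: connect1; rewrite top ?orbT.
    by rewrite es et eqxx in st.
  - by move=> /esym/lower_neq; case.
  - by move=> /lower_neq; case.
  - by move: nis nit; rewrite /new_corner !negb_or; case: s t st => -[]//= _;
      case: ltnP; rewrite ?andbF.
move: e; rewrite corner_vector_upper; case: ifPn => nit e.
  by case: (lower_neq x).
apply: connect_trans (upper_conn t nit).
by apply: IH.
Qed.

Lemma corner_vector_image (i : 'I_n.+1) :
  corner_vector @` @rect_corners a b i =
  [set (B i).1; (B i).2; (B i).1 + (B i).2].
Proof.
apply/seteqP; split=> [_ [x [s sx] <-]|v].
  have low : [set (B i).1; (B i).2; (B i).1 + (B i).2]
      (corner_vector (rect_lower i s)).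
    by rewrite corner_vector_lower; case: eqP => _; left; [right|left].
  case: sx => -> //; rewrite corner_vector_upper.
  by case: (new_corner i s) => //; right.
case=> [[]|] ->.
- exists (rect_lower i right_side); last by rewrite corner_vector_lower.
  by exists right_side; left.
- exists (rect_lower i left_side); last by rewrite corner_vector_lower.
  by exists left_side; left.
- set s := ((p i).1 < (p i).2)%N; exists (rect_upper i s).
    by exists s; right.
  by rewrite corner_vector_upper /new_corner eqxx orbT.
Qed.

Lemma contractionP (x y : rect_vertex a b) :
  contraction x = contraction y <-> corner_vector x = corner_vector y.
Proof.
split=> [e|/connected_corner_vector xy].
  apply/corner_vector_connected.
  have : contraction y y by exact: connect0.
  by rewrite -e.
apply/seteqP; split=> z; rewrite /contraction /=; last exact: connect_trans.
by apply: connect_trans; rewrite conn_sym.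
Qed.

(** The default of [xget] is never used on the classes of the contraction, which
    are not empty. *)
Definition class_vector (c : set (rect_vertex a b)) : N :=
  corner_vector (xget (ord0, left_side) c).

Lemma class_vectorE x : class_vector (contraction x) = corner_vector x.
Proof.
rewrite /class_vector; case: xgetP => [y _ xy|/(_ x)[]]; last exact: connect0.
exact/esym/corner_vector_connected.
Qed.

End Contraction.

(** * The anthyphairetic triangle and the lotus *)

Theorem proposition5p3 (R : realType) (N : zmodType) (NR : lmodType R)
    (iota : {additive N -> NR}) (e1 e2 : N) (a b : nat) :
  is_real_extension iota -> is_basis e1 e2 ->
  (0 < a)%N -> (0 < b)%N -> coprime a b ->
  sc_isomorphic (anthyphairetic_triangle a b) (lotus iota e1 e2 a b).
Proof.
move=> iota_ext be a0 b0 ab.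
have cab : coprime_pos (a, b) by apply/and3P.
pose B := petal_basis e1 e2 a b.
pose phi (c : set (rect_vertex a b)) := iota (class_vector e1 e2 c).
have phiE i : phi @` ((@contraction a b) @` @rect_corners a b i) =
    petal iota (B i).1 (B i).2.
  rewrite -image_comp.
  transitivity (iota @` (@corner_vector N e1 e2 a b @` @rect_corners a b i)).
    rewrite !image_comp; apply: eq_imagel => x _ /=.
    by rewrite /phi class_vectorE.
  by rewrite corner_vector_image // !image_setU !image_set1.
apply: (@generated_complex_isomorphic _ _ _ _ _ _ phi).
  apply/seteqP; split=> [s [f [g [[bf f0 g0] meets ->]]]|_ [_ [i ->] <-]].
    have [m [k [m0 k0 vE]]] :=
      (petal_interior_meets_segment iota_ext _ bf).1 meets.
    have [i ilen fgE] := basis_around_is_petal_basis cab be bf f0 g0 m0 k0 vE.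
    exists ((@contraction a b) @` @rect_corners a b (inord i)).
      by exists (inord i).
    rewrite phiE inordK // /B; case: fgE => <- //=.
    by rewrite /petal [X in X `|` _]setUC (addrC g).
  have ilen : (i <= anthyphairetic_length a b)%N by rewrite -ltnS ltn_ord.
  have bB := petal_basis_is_basis a b i be.
  have [B1 B2] := petal_basis_nonneg e1 e2 a b (leq0n i).
  exists (B i).1, (B i).2; split=> //.
  apply/(petal_interior_meets_segment iota_ext _ bB).
  have /and3P[m0 k0 _] := coprime_pos_pair cab ilen.
  by do 2 eexists; split; [exact: m0 | exact: k0 | exact: petal_basis_pair].
have vertexP c : c \in \bigcup_(t in @anthyphairetic_triangles a b) t ->
    exists x, c = contraction x.
  by rewrite inE => -[_ [i ->] [x _ <-]]; exists x.
move=> c d /vertexP[x ->] /vertexP[y ->].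
by rewrite /phi !class_vectorE //
  => /(real_extension_injective iota_ext be)/contractionP ->.
Qed.
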